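(* Let $Q$ be a real symmetric $n\times n$ matrix, $c\in\mathbf{R}^n$, $A\in\mathbf{R}^{m\times n}$ with rows $A_1,\dots,A_m$, and $b\in\mathbf{R}^m$. If $X=\{x\in\mathbf{R}^n:Ax\le b\}$ is a polytope, then the problem $$\begin{array}{ll}\max & \ell\\ \text{s.t.} & x^TQx+2c^Tx-\ell+\sum_{i=1}^m\alpha_i(x)(A_ix-b_i)\in P[x],\\ & \alpha_i\in\mathcal{A}_+(X),\ i=1,\dots,m,\end{array}$$ with variables $\ell\in\mathbf{R}$ and affine functions $\alpha_i$, is feasible.
   Context: $P[x]$ is the set of polynomials nonnegative on $\mathbf{R}^n$. $\mathcal{A}_+(X)$ is the set of affine functions $\mathbf{R}^n\to\mathbf{R}$ that are nonnegative on $X$. Polytopes are bounded and nonempty throughout. *)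

(* Defs.v *)
From HB Require Import structures.
From mathcomp Require Import all_boot all_order all_algebra.
From mathcomp Require Import all_classical all_reals all_analysis.
(* mpoly's notations clash with those of MathComp-Analysis. *)
From mathcomp Require Import -(notations) mpoly.
Set Implicit Arguments.
Unset Strict Implicit.
Unset Printing Implicit Defensive.
Import Order.TTheory GRing.Theory Num.Theory numFieldNormedType.Exports.
Local Open Scope classical_set_scope.
Local Open Scope ring_scope.

Definition polyhedron (R : realType) (m n : nat) (A : 'M[R]_(m, n))
    (b : 'cV[R]_m) : set 'cV[R]_n :=
  [set x | forall i, (A *m x) i 0 <= b i 0].

Definition is_polytope (R : realType) (n : nat) (X : set 'cV[R]_n) : Prop :=
  [/\ exists m (A : 'M[R]_(m, n)) (b : 'cV[R]_m), X = polyhedron A b,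
      bounded_set X & X !=set0].

Definition is_affine (R : realType) (n : nat) (f : 'cV[R]_n -> R) : Prop :=
  exists (a : 'cV[R]_n) (a0 : R), forall x, f x = (a^T *m x) 0 0 + a0.

(* The set A_+(X). *)
Definition nonneg_affine (R : realType) (n : nat) (X : set 'cV[R]_n) :
    set ('cV[R]_n -> R) :=
  [set f | is_affine f /\ forall x, X x -> 0 <= f x].

(* The set P[x]: as R is infinite, polynomials are identified with the
   functions they induce on R^n. *)
Definition nonneg_poly (R : realType) (n : nat) : set ('cV[R]_n -> R) :=
  [set f | (exists p : mpoly n R, forall x : 'cV[R]_n,
                f x = meval (fun j => x j 0) p) /\
           forall x : 'cV[R]_n, 0 <= f x].

(* The feasible points (l, alpha) of the maximization problem. *)
Definition feasible_set (R : realType) (m n : nat) (Q : 'M[R]_n)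
    (c : 'cV[R]_n) (A : 'M[R]_(m, n)) (b : 'cV[R]_m) :
    set (R * ('I_m -> 'cV[R]_n -> R)) :=
  [set la | let: (l, alpha) := la in
    nonneg_poly (fun x : 'cV[R]_n =>
      (x^T *m Q *m x) 0 0 + 2 * (c^T *m x) 0 0 - l
      + \sum_(i < m) alpha i x * ((A *m x) i 0 - b i 0)) /\
    forall i, nonneg_affine (polyhedron A b) (alpha i)].

(* Main.v *)
(** Since X is nonempty and bounded, its recession cone {d | A d <= 0} is
trivial, so by a Farkas-type argument every vector is a nonnegative combination
of the rows of A; in particular there is L >= 0 with A^T L = I.  If X lies in
the ball of radius M for the max-norm, the affine functions
alpha_i(x) = K (L (x + M))_i are nonnegative on X and
  sum_i alpha_i(x) (A_i x - b_i) = K sum_j (x_j + M) (x_j - (L^T b)_j).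
For K large this makes the quadratic part of the objective positive definite,
and then any small enough l works. *)
Require Import Defs.
From HB Require Import structures.
From mathcomp Require Import all_boot all_order all_algebra.
From mathcomp Require Import all_classical all_reals all_analysis.
From mathcomp Require Import -(notations) mpoly.
From mathcomp Require Import ring lra.
Set Implicit Arguments.
Unset Strict Implicit.
Unset Printing Implicit Defensive.
Import Order.TTheory GRing.Theory Num.Theory numFieldNormedType.Exports.
Local Open Scope classical_set_scope.
Local Open Scope ring_scope.

Lemma mx_coord_le_norm (R : realType) m n (x : 'M[R]_(m, n)) i j :
  `|x i j| <= `|x|.
Proof.
rewrite [leRHS]/Num.norm /= mx_normrE; apply/bigmax_geP.
by right => /=; exists (i, j).
Qed.

Lemma continuous_mulmx_entry (R : realType) m n (B : 'M[R]_(n, m)) i :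
  continuous (fun d : 'rV[R]_n => (d *m B) 0 i).
Proof.
under eq_fun do rewrite mxE.
apply: continuous_big => [|j _ d]; first exact: add_continuous.
exact: cvgM (@coord_continuous R 1 n 0 j d) (cvg_cst _).
Qed.

(** The squared positive part has slope [2 * Num.max a 0] at [a], and this slope is 2-Lipschitz, so
    moving by [s] exceeds the tangent by at most [s ^+ 2]. This bounds the increments of the
    function [g] below. *)
Lemma sqr_maxD (R : realDomainType) (a s : R) :
  Num.max (a + s) 0 ^+ 2 <= Num.max a 0 ^+ 2 + 2 * Num.max a 0 * s + s ^+ 2.
Proof.
by case: (leP (a + s) 0) => h1; case: (leP a 0) => h2; nra.
Qed.

Lemma eq0_of_quadratic_ge0 (R : realFieldType) (a c : R) :
  (forall t, 0 <= t * a + t ^+ 2 * c) -> a = 0.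
Proof.
move=> h.
(* The contradiction comes from t = - a k, with k c < 1. *)
pose k := (1 + `|c|)^-1.
have c0 : 0 < 1 + `|c| by rewrite ltr_pwDl.
have k0 : 0 < k by rewrite invr_gt0.
have hk : k * (1 + `|c|) = 1 by rewrite mulVf ?gt_eqF.
have := h (- (a * k)).
have -> : - (a * k) * a + (- (a * k)) ^+ 2 * c = a ^+ 2 * (k * (k * c - 1)) by ring.
have hc : k * c < 1.
  have := ler_norm c; nra.
apply: contraTeq => a0; rewrite -ltNge.
rewrite pmulr_rlt0 ?exprn_even_gt0//= pmulr_rlt0//; lra.
Qed.

(* Any v is a nonnegative combination of the columns of B: the function
d |-> sum_i max((d B)_i, 0)^2 - 2 d v is coercive, and the vanishing of its
gradient at a minimizer d says that y_i = max((d B)_i, 0) solves B y = v. *)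
Section farkas.
Variables (R : realType) (m n : nat) (B : 'M[R]_(n, m)).

Let g (d : 'rV[R]_n) : R := \sum_i Num.max ((d *m B) 0 i) 0 ^+ 2.

Let g_continuous : continuous g.
Proof.
apply: continuous_big => [|i _ d]; first exact: add_continuous.
have h0 : {for d, continuous (fun _ : 'rV[R]_n => 0 : R^o)}.
  exact: cst_continuous.
have h := continuous_max (@continuous_mulmx_entry _ _ _ B i d) h0.
exact: continuous_comp h (@exprn_continuous _ 2 _).
Qed.

Hypothesis B_recession : forall d : 'rV[R]_n,
  (forall i, (d *m B) 0 i <= 0) -> d = 0.

Let g_gt0 d : d != 0 -> 0 < g d.
Proof.
move=> d0; rewrite lt_neqAle sumr_ge0 ?andbT; last by move=> *; exact: sqr_ge0.
apply: contra_neq d0 => /esym/eqP; rewrite psumr_eq0 => [/allP h|*]; last exact: sqr_ge0.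
apply: B_recession => i.
have := h i (mem_index_enum _); rewrite sqrf_eq0 /= => /eqP e.
by rewrite -[leRHS]e le_max lexx.
Qed.

Let gZ t d : 0 <= t -> g (t *: d) = t ^+ 2 * g d.
Proof.
move=> t0; rewrite /g mulr_sumr; apply: eq_bigr => i _.
by rewrite -scalemxAl mxE -exprMn maxr_pMr// mulr0.
Qed.

(** Since [g] is homogeneous of degree 2, its minimum over the compact unit sphere serves as [e]; it
    is positive by [g_gt0]. *)
Let g_coercive : exists2 e, 0 < e & forall d, e * `|d| ^+ 2 <= g d.
Proof.
pose S := [set d : 'rV[R]_n | `|d| = 1].
have S_normalize d : d != 0 -> S (`|d|^-1 *: d).
  by move=> d0; rewrite /S/= normrZ normfV normr_id mulVf// normr_eq0.
(* The sphere is empty when [n] is 0; then [d] can only be 0 and any positive constant works. *)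
have [S0|S0] := pselect (S !=set0); last first.
  exists 1 => // d; have [->|d0] := eqVneq d 0.
    by rewrite normr0 expr0n/= mulr0 sumr_ge0// => *; exact: sqr_ge0.
  by exfalso; apply: S0; exists (`|d|^-1 *: d); exact: S_normalize.
have S_compact : compact S.
  apply: bounded_closed_compact.
    by exists 1; split; [exact: num_real | move=> M M1 d /= ->; exact: ltW].
  rewrite /S (_ : mkset _ = (fun d : 'rV[R]_n => `|d|) @^-1` [set 1]) //.
  by move/continuous_closedP: (@norm_continuous R 'rV[R]_n); apply; exact: closed_eq.
have [c /set_mem Sc cmin] := EVT_min_rV S0 S_compact
  (continuous_subspaceT g_continuous).
exists (g c).
  by apply: g_gt0; rewrite -normr_eq0 Sc oner_neq0.
move=> d; have [->|d0] := eqVneq d 0.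
  by rewrite normr0 expr0n/= mulr0 sumr_ge0// => *; exact: sqr_ge0.
have dpos : 0 < `|d| by rewrite normr_gt0.
have := cmin _ (mem_set (S_normalize d d0)).
rewrite gZ ?invr_ge0// => /(ler_wpM2r (sqr_ge0 `|d|)).
by rewrite mulrAC -exprMn mulVf ?gt_eqF// expr1n mul1r.
Qed.

Lemma nonneg_solution_of_trivial_recession (v : 'cV[R]_n) :
  exists2 y : 'cV[R]_m, B *m y = v & forall i, 0 <= y i 0.
Proof.
have [e e0 ge] := g_coercive.
pose V := \sum_j `|v j 0|.
have Vd (d : 'rV[R]_n) : (d *m v) 0 0 <= V * `|d|.
  rewrite mxE mulr_suml; apply: ler_sum => j _.
  by rewrite (le_trans (ler_norm _))// normrM mulrC ler_wpM2l// mx_coord_le_norm.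
have V0 : 0 <= V by exact: sumr_ge0.
pose f (d : 'rV[R]_n) : R := g d - 2 * (d *m v) 0 0.
(* Beyond this radius, [e *]|w| ^+ 2[dominates]2 * V * [|w|], hence [f w] is at least [f 0], and a
   minimizer over the ball is a global one. *)
pose r : R := 2 * V / e.
have r0 : 0 <= r by rewrite /r divr_ge0 ?mulr_ge0// ltW.
pose K := [set d : 'rV[R]_n | `|d| <= r].
have K0 : K 0 by rewrite /K/= normr0.
have f0 : f 0 = 0.
  rewrite /f /g !mul0mx mxE mulr0 subr0 big1// => i _.
  by rewrite mxE maxxx expr0n.
have K_compact : compact K.
  apply: bounded_closed_compact.
    exists r; split; [exact: num_real | move=> M M1 d /= dr].
    exact: le_trans dr (ltW M1).
  rewrite /K (_ : mkset _ = (fun d : 'rV[R]_n => `|d|) @^-1` [set x | x <= r]) //.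
  by move/continuous_closedP: (@norm_continuous R 'rV[R]_n); apply; exact: closed_le.
have f_continuous : continuous f.
  move=> d; apply: (cvgB (@g_continuous d)).
  exact: cvgM (cvg_cst _) (@continuous_mulmx_entry _ _ _ v 0 d).
have [d _ dmin] := EVT_min_rV (ex_intro _ _ K0) K_compact
  (continuous_subspaceT f_continuous).
have {}dmin w : f d <= f w.
  have [Kw|] := leP `|w| r; first exact: dmin (mem_set Kw).
  rewrite /r ltr_pdivrMr// => Kw.
  apply: le_trans (dmin _ (mem_set K0)) _.
  rewrite f0 /f subr_ge0; apply: le_trans (ge w).
  have := Vd w; have := normr_ge0 w; nra.
pose y : 'cV[R]_m := \col_i Num.max ((d *m B) 0 i) 0.
exists y => [|i]; last by rewrite mxE le_max lexx orbT.
(* Up to a factor 2, this entry is the derivative of [f] at [d] in the direction [w]. Minimality of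
   [d] and [sqr_maxD] give a quadratic in [t] that is nonnegative and has this entry as linear
   coefficient. *)
have key (w : 'rV[R]_n) : (w *m (B *m y - v)) 0 0 = 0.
  apply: (@eq0_of_quadratic_ge0 _ _ (\sum_i (w *m B) 0 i ^+ 2 / 2)) => t.
  have := dmin (d + t *: w); rewrite /f.
  have : g (d + t *: w) <= g d + 2 * t * (w *m (B *m y)) 0 0 +
      t ^+ 2 * \sum_i (w *m B) 0 i ^+ 2.
    rewrite mulmxA mxE /g !mulr_sumr -!big_split/=; apply: ler_sum => i _.
    rewrite mulmxDl -scalemxAl !mxE.
    apply: le_trans (sqr_maxD _ _) _; rewrite le_eqVlt; apply/orP; left.
    apply/eqP; ring.
  rewrite mulmxDl -scalemxAl !mulmxBr !mxE -mulr_suml; lra.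
apply/eqP; rewrite -subr_eq0; apply/eqP/colP => j.
by have := key (delta_mx 0 j); rewrite -rowE !mxE.
Qed.

End farkas.

(** A nonzero [d] would span a ray that starts at a point of the polyhedron and never leaves it,
    against boundedness. *)
Lemma bounded_polyhedron_recession (R : realType) m n (A : 'M[R]_(m, n))
    (b : 'cV[R]_m) (d : 'cV[R]_n) :
  bounded_set (polyhedron A b) -> polyhedron A b !=set0 ->
  (forall i, (A *m d) i 0 <= 0) -> d = 0.
Proof.
move=> /pinfty_ex_gt0[M /= M0 XM] [x0 Xx0] Ad; apply/eqP/negPn/negP => d0.
have dpos : 0 < `|d| by rewrite normr_gt0.
pose t := (M + `|x0| + 1) / `|d|.
have t0 : 0 <= t by rewrite /t divr_ge0// !addr_ge0// ltW.
have : polyhedron A b (x0 + t *: d).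
  move=> i; rewrite mulmxDr -scalemxAr !mxE -[leRHS]addr0 lerD//.
    by have := Xx0 i; rewrite mxE.
  by have := Ad i; rewrite mxE => h; rewrite mulr_ge0_le0.
move=> /XM/= h.
have : `|t *: d| <= M + `|x0|.
  rewrite -[t *: d](addKr x0) addrC (le_trans (ler_normB _ _))// lerD//.
rewrite normrZ ger0_norm// /t divfK ?gt_eqF//; lra.
Qed.

Section polynomial_functions.
Variables (R : realType) (n : nat).
Implicit Types f g : 'cV[R]_n -> R.

(** This is the first half of [nonneg_poly]; the closure properties below show that the objective
    satisfies it without writing out an [mpoly]. *)
Definition polynomial_fun f := exists p : mpoly n R,
  forall x : 'cV[R]_n, f x = meval (fun j => x j 0) p.

Lemma polynomial_fun_cst a : polynomial_fun (fun=> a).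
Proof. by exists (mpolyC n a) => x; rewrite mevalC. Qed.

Lemma polynomial_fun_coord j : polynomial_fun (fun x => x j 0).
Proof. by exists (mpolyX R (mnm1 j)) => x; rewrite mevalXU. Qed.

Lemma polynomial_funD f g : polynomial_fun f -> polynomial_fun g ->
  polynomial_fun (fun x => f x + g x).
Proof. by move=> [p fp] [q gq]; exists (p + q) => x; rewrite mevalD fp gq. Qed.

Lemma polynomial_funM f g : polynomial_fun f -> polynomial_fun g ->
  polynomial_fun (fun x => f x * g x).
Proof. by move=> [p fp] [q gq]; exists (p * q) => x; rewrite mevalM fp gq. Qed.

Lemma polynomial_fun_sum (I : finType) (F : I -> 'cV[R]_n -> R) :
  (forall i, polynomial_fun (F i)) -> polynomial_fun (fun x => \sum_i F i x).
Proof.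
move=> /fin_all_exists[p Fp]; exists (\sum_i p i) => x.
by rewrite raddf_sum; apply: eq_bigr.
Qed.

Lemma polynomial_fun_mulmx p (C : 'M[R]_(p, n)) i :
  polynomial_fun (fun x => (C *m x) i 0).
Proof.
under eq_fun do rewrite mxE; apply: polynomial_fun_sum => j.
by apply: polynomial_funM; [exact: polynomial_fun_cst | exact: polynomial_fun_coord].
Qed.

End polynomial_functions.

(** Each product of two coordinates is at most the sum of squares in absolute value, so the entries
    of [Q] can be bounded one at a time. *)
Lemma quadratic_form_lower_bound (R : realType) n (Q : 'M[R]_n) (x : 'cV[R]_n) :
  - (\sum_i \sum_j `|Q i j|) * \sum_k x k 0 ^+ 2 <= (x^T *m Q *m x) 0 0.
Proof.
set N := \sum_k x k 0 ^+ 2.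
have xN i : x i 0 ^+ 2 <= N.
  by rewrite /N (bigD1 i)//= lerDl sumr_ge0// => *; exact: sqr_ge0.
rewrite mxE.
under [leRHS]eq_bigr do rewrite mxE mulr_suml.
rewrite exchange_big/= mulNr mulr_suml -sumrN; apply: ler_sum => i _.
rewrite mulr_suml -sumrN; apply: ler_sum => j _; rewrite mxE.
have := xN i; have := xN j => hj hi.
have h : `|x j 0 * x i 0| <= N.
  rewrite ler_norml; apply/andP; split; nra.
rewrite mulrAC lerNl (le_trans (ler_norm _))// normrN normrM [leLHS]mulrC.
by rewrite ler_wpM2l.
Qed.

Theorem proposition2 (R : realType) (m n : nat) (Q : 'M[R]_n) (c : 'cV[R]_n)
    (A : 'M[R]_(m, n)) (b : 'cV[R]_m) (Q_sym : Q^T = Q)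
    (X_polytope : is_polytope (polyhedron A b)) :
  feasible_set Q c A b !=set0.
Proof.
case: X_polytope => _ Xbounded X0.
have [L AL L0] : exists2 L : 'M[R]_(m, n), A^T *m L = 1%:M &
    forall i j, 0 <= L i j.
  have rec (d : 'rV[R]_n) : (forall i, (d *m A^T) 0 i <= 0) -> d = 0.
    move=> dA; apply: trmx_inj; rewrite trmx0.
    apply: (bounded_polyhedron_recession Xbounded X0) => i.
    by have := dA i; rewrite -[d]trmxK -trmx_mul mxE trmxK.
  have /fin_all_exists2[l Al l0] j :=
    nonneg_solution_of_trivial_recession rec (col j 1%:M).
  exists (\matrix_(i, j) l j i 0) => [|i j]; last by rewrite mxE.
  apply/matrixP => k j; have /colP/(_ k) := Al j; rewrite !mxE => <-.
  by apply: eq_bigr => i _; rewrite !mxE.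
have [M M0 XM] := pinfty_ex_gt0 Xbounded.
(* The double sum absorbs the possible negativity of [Q]; the extra 1 leaves one full square of each
   coordinate. *)
pose K := 1 + \sum_i \sum_j `|Q i j|.
have K0 : 0 <= K by rewrite addr_ge0// sumr_ge0// => i _; exact: sumr_ge0.
pose alpha i (x : 'cV[R]_n) := K * (L *m (x + const_mx M)) i 0.
pose u := L^T *m b.
have alphaE x : \sum_i alpha i x * ((A *m x) i 0 - b i 0) =
    K * \sum_j (x j 0 + M) * (x j 0 - u j 0).
  transitivity (K * ((x + const_mx M)^T *m L^T *m (A *m x - b)) 0 0).
    rewrite -trmx_mul mxE mulr_sumr; apply: eq_bigr => i _.
    by rewrite /alpha mulrA [in RHS]mxE [in X in _ = _ * X]mxE [(- b) i 0]mxE.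
  have LA : L^T *m A = 1%:M by rewrite -[A]trmxK -trmx_mul AL trmx1.
  rewrite -mulmxA mulmxBr (mulmxA L^T) LA mul1mx mxE; congr (_ * _).
  by apply: eq_bigr => j _; rewrite !mxE.
(* Once [Q] is replaced by its lower bound, the objective separates over the coordinates: [q j] is
   the coefficient of [x j 0], and [l] supplies the constants that complete the squares. *)
pose q j := 2 * c j 0 + K * (M - u j 0).
pose l := - \sum_j (K * M * u j 0 + q j ^+ 2 / 4).
exists (l, alpha); split; last first.
  move=> i; split.
    exists (K *: (row i L)^T), (alpha i 0) => x.
    rewrite /alpha mulmxDr add0r mxE mulrDr linearZ/= trmxK -scalemxAl.
    by rewrite [(_ *: (row i L *m x)) 0 0]mxE -row_mul [row _ _ 0 0]mxE.
  move=> x Xx; rewrite /alpha mulr_ge0// mxE sumr_ge0// => j _.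
  rewrite mulr_ge0// !mxE -lerBlDr sub0r.
  have := XM _ Xx => /= /(le_trans (mx_coord_le_norm x j 0)).
  by rewrite ler_norml => /andP[].
split.
  (* The sum involving [alpha] is handled first, through its closed form [alphaE]. *)
  apply: polynomial_funD; last first.
    under eq_fun do rewrite alphaE.
    apply: polynomial_funM; first exact: polynomial_fun_cst.
    apply: polynomial_fun_sum => j.
    by apply: polynomial_funM; apply: polynomial_funD;
      (exact: polynomial_fun_coord || exact: polynomial_fun_cst).
  apply: polynomial_funD; last exact: polynomial_fun_cst.
  apply: polynomial_funD.
    under eq_fun do rewrite -mulmxA mxE.
    apply: polynomial_fun_sum => j; apply: polynomial_funM.
      by under eq_fun do rewrite mxE; exact: polynomial_fun_coord.
    exact: polynomial_fun_mulmx.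
  by apply: polynomial_funM; [exact: polynomial_fun_cst | exact: polynomial_fun_mulmx].
move=> x; rewrite alphaE.
have Qx := quadratic_form_lower_bound Q x.
(* The right-hand side is \sum_j (x_j + q_j / 2)^2. *)
suff : 0 <= \sum_k x k 0 ^+ 2 - K * \sum_k x k 0 ^+ 2 + 2 * (c^T *m x) 0 0 - l
    + K * \sum_j (x j 0 + M) * (x j 0 - u j 0).
  by move: Qx; rewrite /K; lra.
rewrite /l opprK mxE !mulr_sumr -sumrB -!big_split/=.
apply: sumr_ge0 => j _; rewrite mxE.
rewrite (_ : _ + _ = (x j 0 + q j / 2) ^+ 2) ?sqr_ge0//.
by rewrite /q; field.
Qed.
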